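(* Let $v$ be a finite binary word and let $W=10v$. Then $$H_W(Y,X)=J_v(X,Y).$$ Equivalently, for all $j,q\ge0$, $$h_{q,j}(W)=j_{j,q}(v)=\bigl|\{y\in\mathcal L(v): y \text{ has exactly } j \text{ zeros and } q \text{ ones}\}\bigr|.$$
   Context: For finite binary words, $u\preceq v$ means $u$ is a (not necessarily contiguous) subsequence of $v$, and $D(v)=\{u:u\preceq v\}$ (a set of words, including the empty word). Put $$\partial_1D(v)=\{u1:u\in D(v),\ u1\notin D(v)\},\qquad \mathcal H(v)=\{y\in\partial_1D(v): y<_{\rm lex}v\},\qquad \mathcal L(v)=D(v)\,\dot\cup\,\mathcal H(v),$$ where $<_{\rm lex}$ is the lexicographic order with $0<1$ and with a proper prefix smaller than the word it prefixes. Write $|y|_0,|y|_1$ for the numbers of zeros and ones of $y$, and $$J_v(X,Y)=\sum_{y\in\mathcal L(v)}X^{|y|_0}Y^{|y|_1}=\sum_{a,b\ge0}j_{a,b}(v)X^aY^b.$$ For a binary word $W=\varepsilon_0\varepsilon_1\cdots\varepsilon_{k-1}$ with $R$ ones and $Z$ zeros, put $$C_0(u,v)=\begin{pmatrix} 1 & 0 \\ u & v \end{pmatrix},\qquad C_1(u,v)=\begin{pmatrix} u & v \\ 0 & 1 \end{pmatrix},\qquad M_W(u,v)=C_{\varepsilon_0}(u,v)\cdots C_{\varepsilon_{k-1}}(u,v)$$ (here $u,v$ are indeterminates, unrelated to the word $v$). The polynomial $H_W(u,v)=\sum_{p,q\ge0}h_{p,q}(W)u^pv^q\in\mathbb Z[u,v]$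 is defined by $$\operatorname{tr}M_W(u,v)-u^Rv^Z=1+(u+v-1)H_W(u,v)$$ (the required divisibility by $u+v-1$ always holds). *)

(* Defs.v *)
From HB Require Import structures.
From mathcomp Require Import all_boot all_order all_algebra finmap.
From mathcomp Require Import ring.

Set Implicit Arguments.
Unset Strict Implicit.
Unset Printing Implicit Defensive.

Import Order.TTheory GRing.Theory.

(* The letters 0 and 1 are [false] and [true].                                *)
Definition word := seq bool.

Definition zeros (w : word) : nat := count_mem false w.
Definition ones (w : word) : nat := count_mem true w.

Section Words.
Local Open Scope fset_scope.

Definition D (v : word) : {fset word} :=
  [fset mask (val m) v | m in {: (size v).-tuple bool}].

Lemma in_D (u v : word) : (u \in D v) = subseq u v.
Proof.
apply/imfsetP/subseqP => [[m _ ->] | [m szm ->]].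
  by exists m; rewrite ?size_tuple.
by move/eqP: szm => szm; exists (Tuple szm).
Qed.

Definition partial1D (v : word) : {fset word} :=
  [fset rcons u true | u in D v & rcons u true \notin D v].

Definition lex_lt (y v : word) : bool :=
  ((y : seqlexi bool) < (v : seqlexi bool))%O.

Lemma lex_lt_nil (v : word) : lex_lt [::] v = (v != [::]).
Proof. by case: v. Qed.

Lemma lex_lt_cons_nil (a : bool) (y : word) : lex_lt (a :: y) [::] = false.
Proof. by []. Qed.

Lemma lex_lt_cons (a b : bool) (y v : word) :
  lex_lt (a :: y) (b :: v) = (~~ a && b) || (a == b) && lex_lt y v.
Proof. by rewrite /lex_lt ltxi_cons; case: a b => -[]. Qed.

Definition Hset (v : word) : {fset word} :=
  [fset y in partial1D v | lex_lt y v].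

Definition L (v : word) : {fset word} := D v `|` Hset v.

Lemma disjoint_D_Hset (v : word) : [disjoint D v & Hset v].
Proof.
apply/fdisjointP => y yD; apply: contraL yD; rewrite !inE /= => /andP[+ _].
by case/imfsetP => u /=; rewrite !inE => /andP[_ Du] ->.
Qed.

End Words.

Local Open Scope ring_scope.

(* Z[X, Y] is {poly {poly int}}: the first variable is the outer ['X], the    *)
(* second the inner ['Y], and the coefficient of X^a Y^b in p is p`_a`_b.     *)
Definition J (v : word) : {poly {poly int}} :=
  \sum_(y <- L v) 'X ^+ zeros y * 'Y ^+ ones y.

Definition jcoef (a b : nat) (v : word) : int := (J v)`_a`_b.

Section Matrices.
Variable R : comNzRingType.
Implicit Types u v : R.

Definition mx2 (a b c d : R) : 'M[R]_2 :=
  \matrix_(i, j) if i == 0 then (if j == 0 then a else b)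
                 else (if j == 0 then c else d).

Definition C0 u v : 'M[R]_2 := mx2 1 0
                                   u v.
Definition C1 u v : 'M[R]_2 := mx2 u v
                                   0 1.

Definition M (W : word) u v : 'M[R]_2 :=
  \prod_(e <- W) (if e then C1 u v else C0 u v).

Lemma M_cons e (W : word) u v :
  M (e :: W) u v = (if e then C1 u v else C0 u v) *m M W u v.
Proof. by rewrite /M big_cons. Qed.

Lemma M_row (W : word) u v (i : 'I_2) :
  exists t, M W u v i 0 + M W u v i 1 = 1 + (u + v - 1) * t.
Proof.
elim: W i => [|e W IH] i.
  exists 0; rewrite /M big_nil mulr0 !mxE.
  by case: i => -[|[|//]] ? /=; rewrite ?addr0 ?add0r.
have [t0 E0] := IH 0; have [t1 E1] := IH 1.
have E x y : x * (M W u v 0 0 + M W u v 0 1) + y * (M W u v 1 0 + M W u v 1 1)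
           = (x + y) + (u + v - 1) * (x * t0 + y * t1).
  by rewrite E0 E1; ring.
rewrite M_cons !mxE !big_ord_recl !big_ord0 !addr0.
have -> : lift ord0 ord0 = 1 :> 'I_2 by apply/val_inj.
case: e i => -[[|[|//]] ?]; rewrite !mxE /=.
- exists (1 + u * t0 + v * t1).
  transitivity (u * (M W u v 0 0 + M W u v 0 1) +
                v * (M W u v 1 0 + M W u v 1 1)); first by ring.
  by rewrite E; ring.
- by exists t1; rewrite !mul0r !add0r !mul1r.
- by exists t0; rewrite !mul0r !addr0 !mul1r.
- exists (1 + u * t0 + v * t1).
  transitivity (u * (M W u v 0 0 + M W u v 0 1) +
                v * (M W u v 1 0 + M W u v 1 1)); first by ring.
  by rewrite E; ring.
Qed.

Lemma det2 (A : 'M[R]_2) : \det A = A 0 0 * A 1 1 - A 0 1 * A 1 0.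
Proof.
rewrite (expand_det_row _ 0) !big_ord_recl big_ord0 addr0 /cofactor !det_mx11.
rewrite !mxE /= expr0 expr1 mul1r mulN1r mulrN.
by congr (A _ _ * A _ _ - A _ _ * A _ _); apply/val_inj.
Qed.

Lemma det_M (W : word) u v : \det (M W u v) = u ^+ ones W * v ^+ zeros W.
Proof.
elim: W => [|e W IH]; first by rewrite /M big_nil det1 mulr1.
rewrite M_cons det_mulmx IH det2 /ones /zeros; case: e; rewrite !mxE /= add0n;
by rewrite ?add1n exprS; ring.
Qed.

End Matrices.

Definition HWnum (W : word) : {poly {poly int}} :=
  \tr (M W 'X 'Y) - 'X ^+ ones W * 'Y ^+ zeros W - 1.

Definition HW (W : word) : {poly {poly int}} := HWnum W %/ ('X + 'Y - 1).

Lemma monic_XY1 : 'X + 'Y - 1 \is @monic {poly int}.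
Proof. by rewrite -addrA -polyCB -[_%:P]opprK -polyCN monicXsubC. Qed.

(* The division is exact.                                                     *)
Lemma HW_spec (W : word) :
  \tr (M W 'X 'Y) - 'X ^+ ones W * 'Y ^+ zeros W = 1 + ('X + 'Y - 1) * HW W.
Proof.
have [t0 E0] := M_row W ('X : {poly {poly int}}) 'Y 0.
have [t1 E1] := M_row W ('X : {poly {poly int}}) 'Y 1.
suff E : HWnum W = (M W 'X 'Y 1 0 * t0 + M W 'X 'Y 0 1 * t1
                    - ('X + 'Y - 1) * t0 * t1) * ('X + 'Y - 1).
  have HWE : HW W * ('X + 'Y - 1) = HWnum W.
    by rewrite /HW E Pdiv.IdomainMonic.mulpK ?monic_XY1.
  by rewrite [_ * HW W]mulrC HWE /HWnum [1 + _]addrC subrK.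
rewrite /HWnum -det_M det2 /mxtrace !big_ord_recl big_ord0 addr0.
have -> : lift ord0 ord0 = 1 :> 'I_2 by apply/val_inj.
have -> : M W 'X 'Y 0 0 = 1 + ('X + 'Y - 1) * t0 - M W 'X 'Y 0 1.
  by rewrite -E0 addrK.
have -> : M W 'X 'Y 1 1 = 1 + ('X + 'Y - 1) * t1 - M W 'X 'Y 1 0.
  by rewrite -E1 addrC addKr.
ring.
Qed.

Definition hcoef (p q : nat) (W : word) : int := (HW W)`_p`_q.

(* Main.v *)
(** Write [s = X + Y - 1] and let [a], [c] be the first column of [M v Y X].
    Splitting words by their first letter gives linear recursions along [v].
    They identify the row sums of [M v Y X] with [1 + s * G1], [1 + s * G0],
    where [Ge] enumerates the [u] with [e u] in [D v], and they identify
    [a], [c] with the enumerators of the [u] such that [1 u], respectively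
    [0 u], lies in [partial1D v].  The same kind of recursion shows that the
    enumerator of [Hset v] times [s] is [X (Y a + (X - 1) c - Y det (M v Y X))].
    Expanding the trace of [C1 C0 (M v)] then produces [s] times the enumerator
    of [L v], and [s] can be cancelled. *)
Require Import Defs.
From mathcomp Require Import all_boot all_order all_algebra finmap.
From mathcomp Require Import ring.

Import GRing.Theory.
Local Open Scope ring_scope.
Local Open Scope fset_scope.

(** * Left quotients of finite word sets by a letter *)

Definition lquot (a : bool) (S : {fset word}) : {fset word} :=
  [fset behead y | y in S & ohead y == Some a].

Lemma in_lquot a S u : (u \in lquot a S) = (a :: u \in S).
Proof.
apply/imfsetP/idP => /= [[[|b y]]|auS].
- by rewrite inE andbF.
- by rewrite inE /= => /andP[bS /eqP[<-]] ->.
- by exists (a :: u); rewrite // inE /= auS eqxx.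
Qed.

Lemma in_D_cons a u b v :
  (a :: u \in D (b :: v)) = if a == b then u \in D v else a :: u \in D v.
Proof. by rewrite !in_D /= eq_sym; case: eqP. Qed.

Lemma nil_notin_partial1D v : ([::] \in partial1D v) = false.
Proof. by apply/negbTE/imfsetP => -[[|? ?]]. Qed.

Lemma in_partial1D_rcons u a v :
  (rcons u a \in partial1D v) =
  [&& a, subseq u v & ~~ subseq (rcons u true) v].
Proof.
apply/imfsetP/and3P => /= [[u' + /eqP]|[aT uv nuv]].
  by rewrite inE /= !in_D eqseq_rcons => /andP[? ?] /andP[/eqP-> /eqP->].
by exists u; rewrite ?inE /= ?in_D ?uv // aT.
Qed.

(** The word and its prefix without the last letter both start with [a], so greedy matching of that
    letter treats both conditions alike. Only for empty [u] does the prefix lose the letter, hence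
    the separate case. *)
Lemma in_partial1D_cons a u b v :
  (a :: u \in partial1D (b :: v)) =
  if a == b then u \in partial1D v else a :: u \in partial1D v.
Proof.
case/lastP: u => [|u c].
  rewrite -[[:: a]]/(rcons [::] a) !in_partial1D_rcons nil_notin_partial1D /=.
  by case: a b => -[]; rewrite ?sub0seq.
rewrite -rcons_cons !in_partial1D_rcons /=.
by case: a b => -[].
Qed.

Lemma in_Hset y v : (y \in Hset v) = (y \in partial1D v) && lex_lt y v.
Proof. by rewrite !inE. Qed.

(** * Weight enumerators and their first-letter recursions *)

Section Enumerator.
Local Open Scope ring_scope.
Variables (R : comNzRingType) (x y : R).

Definition wt (S : {fset word}) : R :=
  \sum_(w <- S) x ^+ zeros w * y ^+ ones w.

Lemma wt0 : wt fset0 = 0.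
Proof. by rewrite /wt big_seq_fset0. Qed.

Lemma wt_fsetU (A B : {fset word}) :
  [disjoint A & B] -> wt (A `|` B) = wt A + wt B.
Proof.
move=> /fdisjointP AB; rewrite /wt (big_fsetID _ (mem A)) /=.
congr (_ + _); apply: eq_fbigl => w; rewrite !inE /=.
  by case: (w \in A); rewrite ?orbT ?andbF.
by case wA: (w \in A); rewrite ?(negPf (AB w wA)) ?andbT.
Qed.

Lemma wt_lquot a (S : {fset word}) :
  \sum_(w <- S | ohead w == Some a) x ^+ zeros w * y ^+ ones w =
  (if a then y else x) * wt (lquot a S).
Proof.
(* The side goal holds because [behead] is injective on words with the same first letter. *)
rewrite /wt big_imfset /=; last first.
  move=> [|b s] [|c t] /andP[_ /eqP // Eb] /andP[_ /eqP // Ec] /= ->.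
  by case: Eb Ec => -> [->].
rewrite big_filter big_distrr /=; apply: eq_bigr => -[|b s] //= /eqP[->].
by rewrite /zeros /ones /=; case: a; rewrite add0n add1n exprS; ring.
Qed.

Lemma wt_split (S : {fset word}) :
  wt S = ([::] \in S)%:R + x * wt (lquot false S) + y * wt (lquot true S).
Proof.
have nilE : \sum_(w <- S | w == [::]) x ^+ zeros w * y ^+ ones w =
            ([::] \in S)%:R.
  case nilS: ([::] \in S).
    by rewrite -big_filter filter_pred1_uniq ?fset_uniq // big_seq1 mulr1.
  by rewrite big1_seq // => w /andP[/eqP->]; rewrite nilS.
rewrite -(wt_lquot false) -(wt_lquot true) -nilE.
rewrite /wt (bigID (fun w => ohead w == Some false)) /=.
rewrite [X in _ + X](bigID (fun w => ohead w == Some true)) /=.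
rewrite [X in _ + (X + _)](eq_bigl (fun w => ohead w == Some true));
  last by case=> [|[]].
rewrite [X in _ + (_ + X)](eq_bigl (pred1 [::])); last by case=> [|[]].
ring.
Qed.

Lemma wt_lquot_D a b v :
  wt (lquot a (D (b :: v))) =
  if a == b then wt (D v) else wt (lquot a (D v)).
Proof.
case: ifP => ab; congr wt; apply/fsetP => u;
by rewrite !in_lquot in_D_cons ab.
Qed.

Lemma wt_lquot_partial1D a b v :
  wt (lquot a (partial1D (b :: v))) =
  if a == b then wt (partial1D v) else wt (lquot a (partial1D v)).
Proof.
case: ifP => ab; congr wt; apply/fsetP => u;
by rewrite !in_lquot in_partial1D_cons ab.
Qed.

Lemma wt_D v :
  wt (D v) = 1 + x * wt (lquot false (D v)) + y * wt (lquot true (D v)).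
Proof. by rewrite {1}wt_split in_D sub0seq. Qed.

Lemma wt_partial1D v :
  wt (partial1D v) = x * wt (lquot false (partial1D v))
                     + y * wt (lquot true (partial1D v)).
Proof. by rewrite {1}wt_split nil_notin_partial1D add0r. Qed.

(** No word starting with 1 is below a word starting with 0, so only the quotient by 0 survives. *)
Lemma wt_Hset_false v : wt (Hset (false :: v)) = x * wt (Hset v).
Proof.
have Q0 : lquot false (Hset (false :: v)) = Hset v.
  apply/fsetP => u.
  by rewrite in_lquot !in_Hset in_partial1D_cons lex_lt_cons.
have Q1 : lquot true (Hset (false :: v)) = fset0.
  by apply/fsetP => u; rewrite in_lquot in_Hset lex_lt_cons /= andbF inE.
by rewrite wt_split Q0 Q1 wt0 in_Hset nil_notin_partial1D mulr0 addr0 add0r.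
Qed.

(** Words starting with 0 are automatically below [true :: v], so on them the lexicographic
    condition disappears. *)
Lemma wt_Hset_true v :
  wt (Hset (true :: v)) =
  y * wt (Hset v) + x * wt (lquot false (partial1D v)).
Proof.
have Q0 : lquot false (Hset (true :: v)) = lquot false (partial1D v).
  apply/fsetP => u.
  by rewrite !in_lquot in_Hset in_partial1D_cons lex_lt_cons /= andbT.
have Q1 : lquot true (Hset (true :: v)) = Hset v.
  apply/fsetP => u.
  by rewrite in_lquot !in_Hset in_partial1D_cons lex_lt_cons.
by rewrite wt_split Q0 Q1 in_Hset nil_notin_partial1D add0r addrC.
Qed.

(** * Matrix entries as enumerators *)

Lemma M_nil (i j : 'I_2) : M [::] y x i j = (i == j)%:R.
Proof. by rewrite /M big_nil mxE. Qed.

(** A prepended letter alters one row only, just as it alters only the quotient by that letter. [M]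
    takes [y] first because its first argument goes with the ones. *)
Lemma M_cons0 e W (j : 'I_2) :
  M (e :: W) y x 0 j = if e then y * M W y x 0 j + x * M W y x 1 j
                       else M W y x 0 j.
Proof.
rewrite M_cons mxE !big_ord_recl big_ord0 addr0.
have -> : lift ord0 ord0 = 1 :> 'I_2 by apply/val_inj.
by case: e; rewrite !mxE //= mul1r mul0r addr0.
Qed.

Lemma M_cons1 e W (j : 'I_2) :
  M (e :: W) y x 1 j = if e then M W y x 1 j
                       else y * M W y x 0 j + x * M W y x 1 j.
Proof.
rewrite M_cons mxE !big_ord_recl big_ord0 addr0.
have -> : lift ord0 ord0 = 1 :> 'I_2 by apply/val_inj.
by case: e; rewrite !mxE //= mul1r mul0r add0r.
Qed.

Lemma lquot_D_nil a : lquot a (D [::]) = fset0.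
Proof. by apply/fsetP => u; rewrite in_lquot in_D inE. Qed.

Lemma M_row_sums v :
  M v y x 0 0 + M v y x 0 1 = 1 + (x + y - 1) * wt (lquot true (D v)) /\
  M v y x 1 0 + M v y x 1 1 = 1 + (x + y - 1) * wt (lquot false (D v)).
Proof.
elim: v => [|[] v [IH0 IH1]].
- by rewrite !M_nil !lquot_D_nil wt0 mulr0 !addr0 add0r.
- rewrite !M_cons0 !M_cons1 !wt_lquot_D /= wt_D; split=> //.
  (* The constants give [y + x = 1 + (x + y - 1)]; the extra [x + y - 1] accounts for the empty word
     in [wt_D]. *)
  transitivity (y * (M v y x 0 0 + M v y x 0 1)
                + x * (M v y x 1 0 + M v y x 1 1)); first by ring.
  by rewrite IH0 IH1; ring.
- rewrite !M_cons0 !M_cons1 !wt_lquot_D /= wt_D; split=> //.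
  transitivity (y * (M v y x 0 0 + M v y x 0 1)
                + x * (M v y x 1 0 + M v y x 1 1)); first by ring.
  by rewrite IH0 IH1; ring.
Qed.

Lemma partial1D_nil : partial1D [::] = [fset [:: true]].
Proof.
apply/fsetP => u; rewrite inE; case/lastP: u => [|u a].
  exact: nil_notin_partial1D.
rewrite in_partial1D_rcons subseq0 -[[:: true]]/(rcons [::] true).
by rewrite eqseq_rcons andbC; case: u a => [|? ?] [].
Qed.

(** The recursion is that of the row sums, but homogeneous in the enumerators, as the empty word is
    never in [partial1D v]. *)
Lemma M_col0 v :
  M v y x 0 0 = wt (lquot true (partial1D v)) /\
  M v y x 1 0 = wt (lquot false (partial1D v)).
Proof.
elim: v => [|e v [IH0 IH1]].
  rewrite !M_nil; split.
    have -> : lquot true (partial1D [::]) = [fset [::]].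
      by apply/fsetP => u; rewrite in_lquot partial1D_nil !inE.
    by rewrite /wt big_seq_fset1 mulr1.
  have -> : lquot false (partial1D [::]) = fset0.
    by apply/fsetP => u; rewrite in_lquot partial1D_nil !inE.
  by rewrite wt0.
rewrite M_cons0 M_cons1 (wt_lquot_partial1D true) (wt_lquot_partial1D false).
rewrite wt_partial1D IH0 IH1 [x * _ + _]addrC.
by case: e.
Qed.

Lemma wt_HsetE v :
  (x + y - 1) * wt (Hset v) =
  x * (y * M v y x 0 0 + (x - 1) * M v y x 1 0
       - y * (y ^+ ones v * x ^+ zeros v)).
Proof.
elim: v => [|[] v IH].
- have -> : Hset [::] = fset0.
    by apply/fsetP => -[|a u]; rewrite in_Hset ?nil_notin_partial1D ?andbF inE.
  by rewrite wt0 !M_nil /=; ring.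
- rewrite wt_Hset_true M_cons0 M_cons1 mulrDr (mulrCA _ y) IH.
  (* Reading the extra term of [wt_Hset_true] as a matrix entry closes the recursion. *)
  rewrite -(M_col0 v).2 /ones /zeros /= add1n add0n exprS; ring.
- rewrite wt_Hset_false M_cons0 M_cons1 (mulrCA _ x) IH.
  rewrite /ones /zeros /= add1n add0n exprS; ring.
Qed.

Lemma tr_M10 v :
  let W := [:: true, false & v] in
  \tr (M W y x) - y ^+ ones W * x ^+ zeros W =
  1 + (y + x - 1) * wt (L v).
Proof.
rewrite wt_fsetU ?disjoint_D_Hset //.
rewrite /= /mxtrace !big_ord_recl big_ord0 addr0.
have -> : lift ord0 ord0 = 1 :> 'I_2 by apply/val_inj.
rewrite [y + x]addrC mulrDr wt_HsetE wt_D !M_cons0 !M_cons1.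
have [r0 r1] := M_row_sums v.
(* After the row sums contribute [1 + (x + y - 1) * wt (D v)], the rest of the trace minus the
   determinant is the right side of [wt_HsetE]. *)
have -> : M v y x 0 0 = 1 + (x + y - 1) * wt (lquot true (D v)) - M v y x 0 1.
  by rewrite -r0 addrK.
have -> : M v y x 1 1 = 1 + (x + y - 1) * wt (lquot false (D v)) - M v y x 1 0.
  by rewrite -r1 addrC addKr.
rewrite /ones /zeros /= !add0n !add1n !exprS.
ring.
Qed.

End Enumerator.

Arguments wt {R} x y S.

(** The outer variable marks ones here but zeros in [J], hence the later [swapXY]. *)
Lemma HW_wt v : HW [:: true, false & v] = wt 'Y 'X (L v).
Proof.
have s_neq0 : ('X + 'Y - 1)%R != 0 :> {poly {poly int}}.
  exact/monic_neq0/monic_XY1.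
apply: (mulfI s_neq0); apply: (addrI 1).
by rewrite -HW_spec tr_M10.
Qed.

Lemma swapXY_wt (R : comNzRingType) (S : {fset word}) :
  swapXY (wt 'Y 'X S) = wt 'X 'Y S :> {poly {poly R}}.
Proof.
rewrite /wt rmorph_sum /=; apply: eq_bigr => w _.
by rewrite rmorphM !rmorphXn /= swapXY_X swapXY_Y.
Qed.

Lemma jcoef_card j q v :
  jcoef j q v =
  (#|` [fset y in L v | (zeros y == j) && (ones y == q)] |)%:Z.
Proof.
rewrite /jcoef /J !coef_sum.
rewrite card_fset_sum1 (big_morph Posz PoszD (erefl _)) -big_fset_condE.
rewrite [RHS]big_mkcond; apply: eq_bigr => w _.
rewrite -rmorphXn coefMC coefXn eq_sym.
by case: eqP; rewrite ?mul1r ?mul0r ?coef0 //= coefXn eq_sym; case: eqP.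
Qed.

Theorem theorem3p3 (v W : word) (hW : W = [:: true, false & v]) :
  swapXY (HW W) = J v /\
  (forall j q : nat,
     hcoef q j W = jcoef j q v /\
     jcoef j q v =
       (#|` [fset y in L v | (zeros y == j) && (ones y == q)] |)%:Z).
Proof.
have E : swapXY (HW W) = J v by rewrite hW HW_wt swapXY_wt.
split=> // j q; split; last exact: jcoef_card.
by rewrite /hcoef /jcoef -E coef_swapXY.
Qed.
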